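(* Let $n,k,N\in\mathbb N$, let $\Omega\subseteq\mathbb R^n$ be open, and let $\mathrm H:\Omega\times\mathbb R^{\vec M}\to\mathbb R$ be a Carathéodory function with $\mathrm H(x,\cdot)\in C^1(\mathbb R^{\vec M})$ essentially uniformly in $x\in\Omega$, namely for any $R>0$ there is an increasing modulus of continuity $\omega_R\in C(0,\infty)$ with $\omega_R(0^+)=0$ such that $$\operatorname*{ess\,sup}_{\Omega}\big|\mathrm H(\cdot,\mathbf X'')-\mathrm H(\cdot,\mathbf X')\big|\le\omega_R(|\mathbf X''-\mathbf X'|),\qquad \operatorname*{ess\,sup}_{\Omega}\big|\mathrm H_{,\mathbf X}(\cdot,\mathbf X'')-\mathrm H_{,\mathbf X}(\cdot,\mathbf X')\big|\le\omega_R(|\mathbf X''-\mathbf X'|)$$ for all $\mathbf X'',\mathbf X'\in\mathbb B_R\subseteq\mathbb R^{\vec M}$, and suppose $|\mathrm H(\cdot,\mathbf 0)|\in L^\infty(\Omega)$ and additionally $$\big|\mathrm H_{,\mathbf X}(\cdot,\mathbf 0)\big|\in L^\infty(\Omega).$$ Let $\mathrm E_\infty(u,\Omega)=\operatorname{ess\,sup}_\Omega\mathrm H(\cdot,D^{\vec k}u)$ for $u\in W^{k,\infty}(\Omega;\mathbb R^N)$. Then $\mathrm E_\infty(\cdot,\Omega)$ is Hadamard semi-differentiable and also Penot semi-differentiable on $W^{k,\infty}(\Omega;\mathbb R^N)$, with right semi-differential given by $$\big(\mathfrak D\mathrm E_\infty(\cdot,\Omega)\big)^+_u(\phi)=\lim_{\varepsilon\to0^+}\Bigg(\operatorname*{ess\,sup}_{\{\mathrm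 H(\cdot,D^{\vec k}u)\ge\mathrm E_\infty(u,\Omega)-\varepsilon\}}\Big[\mathrm H_{,\mathbf X}(\cdot,D^{\vec k}u):D^{\vec k}\phi\Big]\Bigg),\qquad u,\phi\in W^{k,\infty}(\Omega;\mathbb R^N).$$ Further, the following properties of Hadamard semi-differential calculus are valid for such functionals: for any fixed $u,\phi\in W^{k,\infty}(\Omega;\mathbb R^N)$, the map $f\mapsto(\mathfrak D f)^+_u(\phi)$ is linear (in the functional $f$); and, with $f=\mathrm E_\infty(\cdot,\Omega)$, the chain rule $$\big(\mathfrak D(G\circ f)\big)^+_u(\phi)=(\mathfrak D G)^+_{f(u)}\big((\mathfrak D f)^+_u(\phi)\big)$$ holds for any Hadamard semi-differentiable map $G:\mathbb R\to\mathfrak Y$, where $(\mathfrak Y,\|\cdot\|)$ is a Banach space.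
   Context: Notation: $\mathbb R^{N\times n^{\otimes j}}_{\mathrm s}$ is the space of tensors in $\mathbb R^N\otimes(\mathbb R^n)^{\otimes j}$ symmetric in the last $j$ indices, $\mathbb R^{\vec M}:=\mathbb R^N\times\mathbb R^{N\times n}\times\cdots\times\mathbb R^{N\times n^{\otimes k}}_{\mathrm s}$ with Euclidean inner product ''$:$'' and norm $|\cdot|$; $\mathbb B_R$ is the open ball of radius $R$ centred at $0$; $D^{\vec k}u:=(u,Du,\dots,D^ku)$; $W^{k,\infty}$ has norm $\|D^{\vec k}u\|_{L^\infty(\Omega)}$. Carathéodory: measurable in $x$ for every $\mathbf X$, continuous in $\mathbf X$ for a.e. $x$. $\mathrm H_{,\mathbf X}$ is the derivative in the second argument. For a map $f$ from a Banach space $\mathfrak X$ to $\mathbb R$ (or a Banach space), $(\mathfrak D f)^+_u(\phi):=\lim_{t\to0^+}\frac{f(u+t\phi)-f(u)}t$. $f$ is (right) Penot semi-differentiable at $u$ in direction $\phi$ if $(\mathfrak D f)^+_u(\phi)=\lim_{t\to0^+,\ \psi\to\phi}\frac{f(u+t\psi)-f(u)}t$ exists, and (right) Hadamard semi-differentiable at $u$ in direction $\phi$ if $(\mathfrak D f)^+_u(\phi)=\lim_{t\to0^+}\frac{f(u(t))-f(u(0))}{t}$ for any path $u:[0,t_0)\to\mathfrak X$, $t_0>0$, with $u(0)=u$ and $u'(0^+)=\phi$. Linearity in $f$ refers to Hadamard semi-differentiable functionals $f$. *)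

(* Defs.v *)
From HB Require Import structures.
From mathcomp Require Import all_boot all_order all_algebra.
From mathcomp Require Import all_classical all_reals all_analysis.
From mathcomp Require Import measurable_realfun ess_sup_inf ring lra.
Set Implicit Arguments.
Unset Strict Implicit.
Unset Printing Implicit Defensive.
Import Order.TTheory GRing.Theory Num.Theory.
Import numFieldNormedType.Exports.
Local Open Scope classical_set_scope.
Local Open Scope ring_scope.

(* n-fold product of a sigma-finite measure, on the product sigma-algebra of
   n.-tuple T. *)
Section tuple_measure.
Context {d : measure_display} {T : measurableType d} {R : realType}.
Variable m1 : {sigma_finite_measure set T -> \bar R}.

Definition tuple_cons n (p : T * n.-tuple T) : n.+1.-tuple T :=
  [the n.+1.-tuple T of p.1 :: p.2].

Definition tuple_uncons n (t : n.+1.-tuple T) : T * n.-tuple T :=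
  (thead t, [tuple of behead t]).

Lemma tuple_consK n : cancel (@tuple_cons n) (@tuple_uncons n).
Proof.
by move=> [x t]; rewrite /tuple_uncons /= theadE; congr pair; exact/val_inj.
Qed.

Lemma measurable_tuple_cons n : measurable_fun setT (@tuple_cons n).
Proof. exact: measurable_cons. Qed.

Lemma measurable_tuple_uncons n : measurable_fun setT (@tuple_uncons n).
Proof.
apply/measurable_fun_pair => /=; first exact: measurable_tnth.
exact: measurable_behead.
Qed.

Section step.
Context n (m : {sigma_finite_measure set (n.-tuple T) -> \bar R}).

Definition tuple_measure_step : set (n.+1.-tuple T) -> \bar R :=
  pushforward (m1 \x m)%E (@tuple_cons n).

Let step0 : tuple_measure_step set0 = 0%E.
Proof. by rewrite /tuple_measure_step /pushforward preimage_set0 measure0. Qed.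

Let step_ge0 A : (0 <= tuple_measure_step A)%E.
Proof. exact: (measure_ge0 (m1 \x m)%E). Qed.

Let step_sigma_additive : semi_sigma_additive tuple_measure_step.
Proof.
have mf := @measurable_tuple_cons n; exact: measure_semi_sigma_additive.
Qed.

HB.instance Definition _ := isMeasure.Build _ _ _ tuple_measure_step
  step0 step_ge0 step_sigma_additive.

Let step_sigma_finite : sigma_finite setT tuple_measure_step.
Proof.
have /sigma_finiteP[F [TF ndF Foo]] := sigma_finiteT m1.
have /sigma_finiteP[G [TG ndG Goo]] := sigma_finiteT m.
exists (fun k => @tuple_uncons n @^-1` (F k `*` G k)).
  rewrite -preimage_bigcup -(preimage_setT (@tuple_uncons n)); congr (_ @^-1` _).
  rewrite -setXTT TF TG predeqE => -[x y]; split.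
    move=> [/= [i _ Fix] [j _ Gjy]]; exists (maxn i j) => //; split.
      by move: x Fix; exact/subsetPset/ndF/leq_maxl.
    by move: y Gjy; exact/subsetPset/ndG/leq_maxr.
  by move=> [i _ []/= ? ?]; split; exists i.
move=> k; have [mF Fk] := Foo k; have [mG Gk] := Goo k; split.
  rewrite -[X in measurable X]setTI; apply: measurable_tuple_uncons => //.
  exact: measurableX.
rewrite /tuple_measure_step /pushforward -comp_preimage.
rewrite (_ : _ \o _ = id) ?preimage_id; last first.
  by apply/funext => p /=; rewrite tuple_consK.
by rewrite product_measure1E// lte_mul_pinfty// ge0_fin_numE.
Qed.

HB.instance Definition _ := Measure_isSigmaFinite.Build _ _ _ tuple_measure_step
  step_sigma_finite.

End step.

Fixpoint tuple_measure n : {sigma_finite_measure set (n.-tuple T) -> \bar R} :=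
  match n with
  | 0 => \d_ ([tuple] : 0.-tuple T)
  | n'.+1 => tuple_measure_step (tuple_measure n')
  end.

End tuple_measure.

Definition caratheodory_measure (R : realType) (T : pointedType)
    (nu : {outer_measure set T -> \bar R}) :
    {measure set (caratheodory_type nu) -> \bar R} :=
  nu : set (caratheodory_type nu) -> \bar R.

Section lebesgue.
Context {R : realType}.

(* Lebesgue measure on 'rV[R]_n: the product of n copies of the one-dimensional
   Lebesgue measure, extended to an outer measure and restricted to its
   Caratheodory sigma-algebra; thus [lebesgue n] is complete and the measurable
   sets of [lebesgue_type n] are all the Lebesgue measurable sets. *)
Definition lebesgue_outer n (A : set 'rV[R]_n) : \bar R :=
  mu_ext (tuple_measure (@lebesgue_measure R) n)
    [set t : n.-tuple (measurableTypeR R) | A (\row_i tnth t i)].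

Section outer.
Variable n : nat.
Local Notation nu := (tuple_measure (@lebesgue_measure R) n).

Let lebesgue_outer0 : @lebesgue_outer n set0 = 0%E.
Proof. by rewrite /lebesgue_outer mu_ext0. Qed.

Let lebesgue_outer_ge0 A : (0 <= @lebesgue_outer n A)%E.
Proof. by rewrite /lebesgue_outer mu_ext_ge0. Qed.

Let le_lebesgue_outer : {homo @lebesgue_outer n : A B / A `<=` B >-> (A <= B)%E}.
Proof. by move=> A B AB; apply: le_mu_ext => t; exact: AB. Qed.

Let lebesgue_outer_sigma_subadditive : sigma_subadditive (@lebesgue_outer n).
Proof.
move=> F; rewrite /lebesgue_outer.
by rewrite (_ : [set t | _] = \bigcup_k [set t | F k (\row_i tnth t i)]);
  [exact: mu_ext_sigma_subadditive|].
Qed.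

HB.instance Definition _ := isOuterMeasure.Build R 'rV[R]_n (@lebesgue_outer n)
  lebesgue_outer0 lebesgue_outer_ge0 le_lebesgue_outer
  lebesgue_outer_sigma_subadditive.
End outer.

Definition lebesgue_outer_measure n : {outer_measure set 'rV[R]_n -> \bar R} :=
  @lebesgue_outer n.

Definition lebesgue_display n : measure_display :=
  caratheodory_display (lebesgue_outer_measure n).

Definition lebesgue_type n : measurableType (lebesgue_display n) :=
  caratheodory_type (lebesgue_outer_measure n).

Definition lebesgue n : {measure set (lebesgue_type n) -> \bar R} :=
  caratheodory_measure (lebesgue_outer_measure n).

End lebesgue.

#[global] Instance lebesgue_ae_filter (R : realType) n :
  Filter (almost_everywhere (@lebesgue R n)).
Proof. exact: ae_filter_ringOfSetsType. Qed.

Section ess_sup_on.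
Context {R : realType} {n : nat}.
Local Notation mu := (@lebesgue R n).

(* The value -oo outside A restricts [ess_sup] to A; in particular it is -oo
   when A is negligible. *)
Definition ess_sup_on (A : set 'rV[R]_n) (f : 'rV[R]_n -> R) : \bar R :=
  ess_sup mu (fun x => if x \in A then (f x)%:E else -oo%E).

Lemma ess_sup_onP A f y :
  (ess_sup_on A f <= y)%E <-> \forall x \ae mu, A x -> ((f x)%:E <= y)%E.
Proof.
split=> [/ess_supP|] h; last apply/ess_supP.
  by apply: filterS h => x /=; case: ifPn => [//|/negP Ax _ /mem_set].
apply: filterS h => x /=; case: ifPn => [/set_mem Ax h|_ _]; first exact: h.
by rewrite leNye.
Qed.

Lemma ess_sup_on_ltyP A (f : 'rV[R]_n -> R) :
  (ess_sup_on A f < +oo)%E <-> exists M : R, \forall x \ae mu, A x -> f x <= M.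
Proof.
split=> [|[M hM]].
  have /ess_sup_onP h := lexx (ess_sup_on A f).
  case: (ess_sup_on A f) h => [r||] h // _.
    by exists r; apply: filterS h => x h /h; rewrite lee_fin.
  by exists 0; apply: filterS h => x h /h; rewrite leeNy_eq.
apply: (@le_lt_trans _ _ M%:E); last exact: ltry.
by apply/ess_sup_onP; apply: filterS hM => x h /h; rewrite lee_fin.
Qed.

End ess_sup_on.

(* R^N x R^(N x n) x ... x R_s^(N x n^(tensor k)): the entry of index
   (j, (i, s)) is the one of order j, component i and derivative word
   s = (s_1, ..., s_j). Symmetry in the last j indices is invariance under
   permutations of s. The inner product sums over all words, so it is the
   Euclidean one of the tensor spaces. *)
Section jet.
Variables (R : realType) (n k N : nat).

Definition jet_index : finType :=
  {j : 'I_k.+1 & ('I_N * (nat_of_ord j).-tuple 'I_n)%type}.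

Definition jidx (j : 'I_k.+1) (i : 'I_N) (s : j.-tuple 'I_n) : jet_index :=
  Tagged (fun j : 'I_k.+1 => ('I_N * (nat_of_ord j).-tuple 'I_n)%type) (i, s).

Definition jet_symmetric : {pred {ffun jet_index -> R}} := fun X =>
  [forall j : 'I_k.+1, forall i : 'I_N, forall s : j.-tuple 'I_n,
   forall t : j.-tuple 'I_n, perm_eq s t ==> (X (jidx i s) == X (jidx i t))].

Lemma jet_symmetricP (X : {ffun jet_index -> R}) : reflect
  (forall (j : 'I_k.+1) (i : 'I_N) (s t : j.-tuple 'I_n),
     perm_eq s t -> X (jidx i s) = X (jidx i t)) (X \in jet_symmetric).
Proof.
apply: (iffP forallP) => h j => [i s t st|].
  by move: h => /(_ j)/forallP/(_ i)/forallP/(_ s)/forallP/(_ t)/implyP/(_ st)/eqP.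
by do 3 apply/forallP => ?; apply/implyP => st; apply/eqP/h.
Qed.

Lemma jet_symmetric_submod_closed : submod_closed jet_symmetric.
Proof.
split=> [|a X Y /jet_symmetricP hX /jet_symmetricP hY];
  apply/jet_symmetricP => j i s t st; rewrite !ffunE//.
by rewrite (hX _ _ _ _ st) (hY _ _ _ _ st).
Qed.

HB.instance Definition _ := GRing.isSubmodClosed.Build R {ffun jet_index -> R}
  jet_symmetric jet_symmetric_submod_closed.

Record jet := Jet {
  jet_val :> {ffun jet_index -> R} ;
  _ : jet_val \in jet_symmetric }.

HB.instance Definition _ := [isSub for jet_val].
HB.instance Definition _ := [Choice of jet by <:].
HB.instance Definition _ := [SubChoice_isSubLmodule of jet by <:].

Definition jet_dot (X Y : jet) : R := \sum_(a : jet_index) X a * Y a.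
Definition jet_norm (X : jet) : R := Num.sqrt (jet_dot X X).

Lemma jetDE (X Y : jet) a : (X + Y) a = X a + Y a.
Proof. by rewrite -[LHS]/((val (X + Y)) a) raddfD ffunE. Qed.

Lemma jetZE c (X : jet) a : (c *: X) a = c * X a.
Proof. by rewrite -[LHS]/((val (c *: X)) a) linearZ ffunE. Qed.

Lemma jet0E a : (0 : jet) a = 0.
Proof. by rewrite -[LHS]/((val (0 : jet)) a) raddf0 ffunE. Qed.

Lemma jet_dotC X Y : jet_dot X Y = jet_dot Y X.
Proof. by apply: eq_bigr => a _; rewrite mulrC. Qed.

Lemma jet_dotDl X Y Z : jet_dot (X + Y) Z = jet_dot X Z + jet_dot Y Z.
Proof. by rewrite -big_split; apply: eq_bigr => a _; rewrite jetDE mulrDl. Qed.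

Lemma jet_dotZl c X Y : jet_dot (c *: X) Y = c * jet_dot X Y.
Proof. by rewrite mulr_sumr; apply: eq_bigr => a _; rewrite jetZE mulrA. Qed.

Lemma jet_dot_ge0 X : 0 <= jet_dot X X.
Proof. by apply: sumr_ge0 => a _; rewrite -expr2 sqr_ge0. Qed.

Lemma jet_norm_sqr X : jet_norm X ^+ 2 = jet_dot X X.
Proof. by rewrite sqr_sqrtr// jet_dot_ge0. Qed.

Lemma jet_norm_eq0 X : jet_norm X = 0 -> X = 0.
Proof.
move=> X0; have /eqP : jet_dot X X = 0 by rewrite -jet_norm_sqr X0 expr0n.
rewrite psumr_eq0 => [/allP h|a _]; last by rewrite -expr2 sqr_ge0.
apply/val_inj/ffunP => a; rewrite -[RHS]/((0 : jet) a) jet0E.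
by have /implyP/(_ isT) := h a (mem_index_enum _); rewrite mulf_eq0 orbb => /eqP.
Qed.

Lemma jet_dot_le X Y : jet_dot X Y <= jet_norm X * jet_norm Y.
Proof.
have [X0|X0] := eqVneq (jet_norm X) 0.
  rewrite X0 mul0r (jet_norm_eq0 X0) /jet_dot big1// => a _.
  by rewrite jet0E mul0r.
have [Y0|Y0] := eqVneq (jet_norm Y) 0.
  rewrite Y0 mulr0 (jet_norm_eq0 Y0) /jet_dot big1// => a _.
  by rewrite jet0E mulr0.
have XY0 : 0 < jet_norm X * jet_norm Y.
  by rewrite mulr_gt0// lt0r ?X0 ?Y0 sqrtr_ge0.
have := jet_dot_ge0 (jet_norm Y *: X + (- jet_norm X) *: Y).
rewrite jet_dotDl !jet_dotZl ![jet_dot _ (_ + _)]jet_dotC !jet_dotDl !jet_dotZl.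
rewrite -!jet_norm_sqr (jet_dotC Y X).
set d := jet_dot X Y; set x := jet_norm X; set y := jet_norm Y.
rewrite (_ : _ + _ = 2 * (x * y) * (x * y - d)); last first.
  by ring.
by rewrite pmulr_rge0 ?subr_ge0// mulr_gt0.
Qed.

Lemma jet_norm_triangle X Y : jet_norm (X + Y) <= jet_norm X + jet_norm Y.
Proof.
rewrite -ler_sqr ?nnegrE ?addr_ge0 ?sqrtr_ge0//.
rewrite jet_norm_sqr sqrrD !jet_norm_sqr jet_dotDl !(jet_dotC _ (X + Y)).
rewrite !jet_dotDl (jet_dotC Y X).
have := jet_dot_le X Y; lra.
Qed.

Lemma jet_normZ c X : jet_norm (c *: X) = `|c| * jet_norm X.
Proof.
rewrite /jet_norm jet_dotZl jet_dotC jet_dotZl mulrA -expr2.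
by rewrite sqrtrM ?sqr_ge0// sqrtr_sqr.
Qed.

HB.instance Definition _ := Lmodule_isNormed.Build R jet
  jet_norm_triangle jet_normZ jet_norm_eq0.

(* The derivative of h as an element of the (symmetric) tensor space, by Riesz
   representation for [jet_dot]; meaningful where h is differentiable. *)
Definition gradient (h : jet -> R) (X : jet) : jet :=
  xget 0 [set G | forall F, 'd h X F = jet_dot G F].

Definition C1 (h : jet -> R) :=
  (forall X, differentiable h X) /\ continuous (gradient h).

End jet.

Section test_functions.
Context {R : realType} {n : nat}.

Definition partial (i : 'I_n) (phi : 'rV[R]_n -> R) : 'rV[R]_n -> R :=
  fun x => 'D_(delta_mx 0 i) phi x.

Definition partials (s : seq 'I_n) (phi : 'rV[R]_n -> R) : 'rV[R]_n -> R :=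
  foldr partial phi s.

Definition smooth (phi : 'rV[R]_n -> R) := forall (s : seq 'I_n) (x : 'rV[R]_n),
  {for x, continuous (partials s phi)} /\
  forall i, derivable (partials s phi) x (delta_mx 0 i).

Definition support_cl (phi : 'rV[R]_n -> R) : set 'rV[R]_n :=
  closure [set x | phi x != 0].

Definition test_function (Omega : set 'rV[R]_n) (phi : 'rV[R]_n -> R) :=
  [/\ smooth phi, compact (support_cl phi) & support_cl phi `<=` Omega].

End test_functions.

Section sobolev.
Context {R : realType} {n : nat}.
Variables (k N : nat) (Omega : set 'rV[R]_n).
Local Notation jet := (jet R n k N).
Local Notation mu := (@lebesgue R n).
Local Open Scope quotient_scope.

Definition jet_base (X : jet) (i : 'I_N) : R :=
  X (@jidx n k N ord0 i [tuple]).

(* U x = (u x, D u x, ..., D^k u x) with u = jet_base U, the derivatives being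
   weak in Omega. Since phi and its partial derivatives vanish outside Omega,
   integrals over the whole space are integrals over Omega and do not depend on
   the values of U outside Omega. The integrability clauses are automatic for
   essentially bounded U. *)
Definition weak_jet (U : 'rV[R]_n -> jet) :=
  forall (phi : 'rV[R]_n -> R), test_function Omega phi ->
  forall (j : 'I_k.+1) (i : 'I_N) (s : j.-tuple 'I_n),
  [/\ mu.-integrable setT (fun x => (jet_base (U x) i * partials s phi x)%:E),
      mu.-integrable setT (fun x => (U x (jidx i s) * phi x)%:E) &
      (\int[mu]_x (jet_base (U x) i * partials s phi x) =
       (-1) ^+ j * \int[mu]_x (U x (jidx i s) * phi x))%R].

(* W^(k,oo)(Omega; R^N) is presented through the injection
   u |-> (u, D u, ..., D^k u), which is the map that defines its norm: weak
   derivatives being unique up to null sets, a class of jets satisfying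
   [is_sobolev] is the same thing as an element u of the Sobolev space together
   with its weak derivatives. *)
Definition is_sobolev (U : 'rV[R]_n -> jet) :=
  [/\ forall a, measurable_fun (Omega : set (lebesgue_type n)) (fun x => U x a),
      (ess_sup_on Omega (fun x => `|U x|%R) < +oo)%E &
      weak_jet U].

Definition sobolev_pred : {pred 'rV[R]_n -> jet} := fun U => `[< is_sobolev U >].

Lemma sobolev_submod_closed : submod_closed sobolev_pred.
Proof.
split.
  apply/asboolP; split.
  - by move=> a; under eq_fun do rewrite [_ a]jet0E; exact: measurable_cst.
  - apply/ess_sup_on_ltyP; exists 0; apply: aeW => x _.
    by rewrite [X in `|X|](_ : _ = 0)// normr0.
  - move=> phi _ j i s.
    have z x a : (((0 : 'rV[R]_n -> jet) x) a) = 0 by exact: jet0E.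
    have z1 x : jet_base ((0 : 'rV[R]_n -> jet) x) i * partials s phi x = 0.
      by rewrite /jet_base z mul0r.
    have z2 x : ((0 : 'rV[R]_n -> jet) x) (jidx i s) * phi x = 0.
      by rewrite z mul0r.
    split.
    + by under eq_fun do rewrite z1; exact: integrable0.
    + by under eq_fun do rewrite z2; exact: integrable0.
    + rewrite /Rintegral !integral0_eq ?mulr0//= => x _; last by rewrite z1.
      by rewrite z2.
move=> c U V /asboolP[mU bU wU] /asboolP[mV bV wV]; apply/asboolP.
have cUV x a : ((c *: U + V) x) a = c * U x a + V x a.
  by rewrite -[LHS]/((c *: U x + V x) a) jetDE jetZE.
split.
- move=> a; under eq_fun do rewrite cUV.
  exact: (measurable_funD (measurable_funM (measurable_cst c) (mU a)) (mV a)).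
- move/ess_sup_on_ltyP : bU => [M hM]; move/ess_sup_on_ltyP : bV => [M' hM'].
  apply/ess_sup_on_ltyP; exists (`|c| * M + M').
  apply: filterS2 hM hM' => x hM hM' Ox.
  rewrite -[X in `|X|]/(c *: U x + V x).
  rewrite (le_trans (ler_normD _ _))// lerD ?hM'// normrZ.
  by rewrite ler_wpM2l// hM.
- move=> phi tphi j i s.
  have [U1 U2 U3] := wU _ tphi j i s.
  have [V1 V2 V3] := wV _ tphi j i s.
  have e1 x : jet_base ((c *: U + V) x) i * partials s phi x =
      c * (jet_base (U x) i * partials s phi x) + jet_base (V x) i * partials s phi x.
    by rewrite /jet_base cUV mulrDl mulrA.
  have e2 x : ((c *: U + V) x) (jidx i s) * phi x =
      c * (U x (jidx i s) * phi x) + V x (jidx i s) * phi x.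
    by rewrite cUV mulrDl mulrA.
  have i1 := integrableD measurableT (integrableZl measurableT c U1) V1.
  have i2 := integrableD measurableT (integrableZl measurableT c U2) V2.
  split.
  + by apply: eq_integrable i1 => // x _; rewrite e1 EFinD EFinM.
  + by apply: eq_integrable i2 => // x _; rewrite e2 EFinD EFinM.
  + under eq_Rintegral do rewrite e1.
    under [in RHS]eq_Rintegral do rewrite e2.
    rewrite !RintegralD// ?RintegralZl// ?U3 ?V3; first by ring.
    * exact: (integrableZl measurableT c U2).
    * exact: (integrableZl measurableT c U1).
Qed.

HB.instance Definition _ := GRing.isSubmodClosed.Build R ('rV[R]_n -> jet)
  sobolev_pred sobolev_submod_closed.

Record sobolev_fun := SobolevFun {
  sobolev_val :> 'rV[R]_n -> jet ;
  _ : sobolev_val \in sobolev_pred }.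

HB.instance Definition _ := [isSub for sobolev_val].
HB.instance Definition _ := [Choice of sobolev_fun by <:].
HB.instance Definition _ := [SubChoice_isSubLmodule of sobolev_fun by <:].

(* Functions are identified when they agree almost everywhere in Omega. *)
Definition ae_zero : {pred sobolev_fun} := fun U =>
  `[< \forall x \ae mu, Omega x -> U x = 0 >].

Lemma ae_zero_submod_closed : submod_closed ae_zero.
Proof.
split; first by apply/asboolP; exact: aeW.
move=> c U V /asboolP U0 /asboolP V0; apply/asboolP.
apply: filterS2 U0 V0 => x U0 V0 Ox.
rewrite -[LHS]/(c *: U x + V x).
by rewrite U0// V0// scaler0 addr0.
Qed.

HB.instance Definition _ := GRing.isSubmodClosed.Build R sobolev_fun
  ae_zero ae_zero_submod_closed.

Definition sobolev : Type := Quotient.quot ae_zero.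
HB.instance Definition _ := GRing.Zmodule.on sobolev.

Definition sobolev_class (U : sobolev_fun) : sobolev := \pi_(Quotient.quot ae_zero) U.

(* A representative of (u, D u, ..., D^k u). *)
Definition Dvec (u : sobolev) : 'rV[R]_n -> jet :=
  val (repr (u : Quotient.quot ae_zero)).

Lemma sobolev_classP (U V : sobolev_fun) : sobolev_class U = sobolev_class V <->
  \forall x \ae mu, Omega x -> U x = V x.
Proof.
have e : (U - V \in ae_zero) <-> \forall x \ae mu, Omega x -> U x = V x.
  split=> [/asboolP|] h; last apply/asboolP; apply: filterS h => x + Ox => /(_ Ox).
    by move=> /eqP; rewrite -[X in X == _]/(U x - V x) subr_eq0 => /eqP.
  by move=> UV; rewrite -[LHS]/(U x - V x) UV subrr.
by rewrite -e Quotient.idealrBE; split=> /eqP.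
Qed.

Lemma Dvec_class (U : sobolev_fun) :
  \forall x \ae mu, Omega x -> Dvec (sobolev_class U) x = U x.
Proof. by apply/sobolev_classP; rewrite /sobolev_class reprK. Qed.

Lemma sobolev_class_Dvec (u : sobolev) :
  sobolev_class (repr (u : Quotient.quot ae_zero)) = u.
Proof. exact: reprK. Qed.

Lemma sobolev_classD U V :
  sobolev_class (U + V) = sobolev_class U + sobolev_class V.
Proof. by rewrite /sobolev_class Quotient.pi_add. Qed.

Definition sobolev_scale (c : R) (u : sobolev) : sobolev :=
  sobolev_class (c *: (repr (u : Quotient.quot ae_zero) : sobolev_fun)).

Lemma sobolev_scale_class c U :
  sobolev_scale c (sobolev_class U) = sobolev_class (c *: U).
Proof.
apply/sobolev_classP; apply: filterS (Dvec_class U) => x h /h e.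
by rewrite -[RHS]/(c *: U x) -e.
Qed.

Let sobolev_scalerA a b v :
  sobolev_scale a (sobolev_scale b v) = sobolev_scale (a * b) v.
Proof. by rewrite -[v]sobolev_class_Dvec !sobolev_scale_class scalerA. Qed.

Let sobolev_scale1r : left_id 1 sobolev_scale.
Proof. by move=> v; rewrite -[v]sobolev_class_Dvec sobolev_scale_class scale1r. Qed.

Let sobolev_scalerDr : right_distributive sobolev_scale +%R.
Proof.
move=> a u v; rewrite -[u]sobolev_class_Dvec -[v]sobolev_class_Dvec.
by rewrite -sobolev_classD !sobolev_scale_class scalerDr sobolev_classD.
Qed.

Let sobolev_scalerDl v : {morph sobolev_scale^~ v : a b / a + b}.
Proof.
move=> a b /=; rewrite -[v]sobolev_class_Dvec !sobolev_scale_class scalerDl.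
by rewrite sobolev_classD.
Qed.

HB.instance Definition _ := GRing.Zmodule_isLmodule.Build R sobolev
  sobolev_scalerA sobolev_scale1r sobolev_scalerDr sobolev_scalerDl.

Lemma DvecD u v : \forall x \ae mu, Omega x -> Dvec (u + v) x = Dvec u x + Dvec v x.
Proof.
have := Dvec_class (repr (u : Quotient.quot ae_zero) + repr (v : Quotient.quot ae_zero)).
by rewrite sobolev_classD !sobolev_class_Dvec.
Qed.

Lemma DvecZ c u : \forall x \ae mu, Omega x -> Dvec (c *: u) x = c *: Dvec u x.
Proof.
have := Dvec_class (c *: repr (u : Quotient.quot ae_zero)).
by rewrite -sobolev_scale_class sobolev_class_Dvec.
Qed.

Definition sobolev_norm (u : sobolev) : R :=
  fine (ess_sup_on Omega (fun x => `|Dvec u x|)).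

Lemma sobolev_norm_ge0 u : 0 <= sobolev_norm u.
Proof.
rewrite /sobolev_norm; have /ess_sup_onP := lexx (ess_sup_on Omega (fun x => `|Dvec u x|)).
case E : (ess_sup_on _ _) => [r||] //= h; rewrite leNgt; apply/negP => r0.
suff : (ess_sup_on Omega (fun x => `|Dvec u x|%R) <= -oo)%E by rewrite E.
apply/ess_sup_onP; apply: filterS h => x /[apply]; rewrite lee_fin => h.
by have := le_lt_trans h r0; rewrite normr_lt0.
Qed.

Lemma sobolev_norm_leP u (M : R) : 0 <= M ->
  sobolev_norm u <= M <-> \forall x \ae mu, Omega x -> `|Dvec u x| <= M.
Proof.
move=> M0; have eM : (ess_sup_on Omega (fun x => `|Dvec u x|%R) <= M%:E)%E <->
    \forall x \ae mu, Omega x -> `|Dvec u x| <= M.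
  split=> [/ess_sup_onP|] h; last apply/ess_sup_onP.
    by apply: filterS h => x h /h; rewrite lee_fin.
  by apply: filterS h => x h /h; rewrite lee_fin.
have /asboolP[_ + _] : Dvec u \in sobolev_pred.
  by rewrite /Dvec; case: (repr _).
rewrite -eM /sobolev_norm.
case: (ess_sup_on _ _) => [r||] h; [by rewrite lee_fin|by []|].
by split=> // _; rewrite leNye.
Qed.

Lemma Dvec_le_norm u : \forall x \ae mu, Omega x -> `|Dvec u x| <= sobolev_norm u.
Proof. by apply/sobolev_norm_leP; rewrite ?sobolev_norm_ge0. Qed.

Let sobolev_norm_triangle u v :
  sobolev_norm (u + v) <= sobolev_norm u + sobolev_norm v.
Proof.
apply/sobolev_norm_leP; first by rewrite addr_ge0 ?sobolev_norm_ge0.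
apply: filterS3 (DvecD u v) (Dvec_le_norm u) (Dvec_le_norm v).
move=> x + + + Ox => /(_ Ox) -> /(_ Ox) hu /(_ Ox) hv.
by rewrite (le_trans (ler_normD _ _))// lerD.
Qed.

Let sobolev_normZ_le c u : sobolev_norm (c *: u) <= `|c| * sobolev_norm u.
Proof.
apply/sobolev_norm_leP; first by rewrite mulr_ge0 ?sobolev_norm_ge0.
apply: filterS2 (DvecZ c u) (Dvec_le_norm u).
move=> x + + Ox => /(_ Ox) -> /(_ Ox) hu.
by rewrite normrZ ler_wpM2l.
Qed.

Let sobolev_normZ c u : sobolev_norm (c *: u) = `|c| * sobolev_norm u.
Proof.
have [->|c0] := eqVneq c 0.
  apply/eqP; rewrite eq_le sobolev_normZ_le/= normr0 mul0r.
  exact: sobolev_norm_ge0.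
apply/eqP; rewrite eq_le sobolev_normZ_le/=.
rewrite -ler_pdivlMl ?normr_gt0// -normfV.
by rewrite -{1}[u](scalerK c0) sobolev_normZ_le.
Qed.

Let sobolev_norm_eq0 u : sobolev_norm u = 0 -> u = 0.
Proof.
move=> u0; rewrite -[u]sobolev_class_Dvec -[RHS]sobolev_class_Dvec.
apply/sobolev_classP.
have h0 : \forall x \ae mu, Omega x -> Dvec 0 x = 0.
  by have := DvecZ 0 0; rewrite scale0r; apply: filterS => x h /h; rewrite scale0r.
apply: filterS2 h0 (Dvec_le_norm u) => x + + Ox => /(_ Ox) h /(_ Ox).
rewrite u0 normr_le0 => /eqP e.
by rewrite -[LHS]/(Dvec u x) -[RHS]/(Dvec 0 x) e h.
Qed.

HB.instance Definition _ := Lmodule_isNormed.Build R sobolev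
  sobolev_norm_triangle sobolev_normZ sobolev_norm_eq0.

End sobolev.

Section functional.
Context {R : realType} {n k N : nat}.
Variable Omega : set 'rV[R]_n.
Local Notation mu := (@lebesgue R n).
Implicit Types (H : 'rV[R]_n -> jet R n k N -> R).

Definition caratheodory H :=
  (forall X, measurable_fun (Omega : set (lebesgue_type n)) (H ^~ X)) /\
  (\forall x \ae mu, Omega x -> continuous (H x)).

Definition ereal_supremal H (u : sobolev k N Omega) : \bar R :=
  ess_sup_on Omega (fun x => H x (Dvec u x)).

(* When Omega is not empty, [ereal_supremal H u] is a real number for the H
   considered here; for empty Omega it is -oo and [supremal H u] is 0. *)
Definition supremal H (u : sobolev k N Omega) : R := fine (ereal_supremal H u).

Definition ess_sup_superlevel H (u phi : sobolev k N Omega) (eps : R) : \bar R :=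
  ess_sup_on
    [set x | Omega x /\ H x (Dvec u x) >= supremal H u - eps]
    (fun x => jet_dot (gradient (H x) (Dvec u x)) (Dvec phi x)).

End functional.

Section semidifferential.
Context {R : realType} {X Y : normedModType R}.
Implicit Types (f : X -> Y) (u phi : X).

Definition semidiff f u phi : Y :=
  lim ((fun t : R => t^-1 *: (f (u + t *: phi) - f u)) @ 0^'+).

Definition penot_semidiff f u phi :=
  (fun p : R * X => p.1^-1 *: (f (u + p.1 *: p.2) - f u))
    @ filter_prod (0 : R)^'+ (nbhs phi) --> semidiff f u phi.

(* c stands for any path [0, t0[ -> X: only its germ at 0^+ matters. Paths are
   not required to be continuous away from 0. *)
Definition hadamard_semidiff f u phi := forall c : R -> X,
  c 0 = u -> (fun t : R => t^-1 *: (c t - c 0)) @ 0^'+ --> phi ->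
  (fun t : R => t^-1 *: (f (c t) - f (c 0))) @ 0^'+ --> semidiff f u phi.

End semidifferential.

(* Main.v *)
(* Along w = u + t psi with psi close to phi, the mean value theorem and the
   essentially uniform modulus of the gradient give
   H(., w) = H(., u) + t (H_X(., u) : phi) + o(t) in L^oo(Omega). The difference
   quotient of the essential supremum is thus squeezed between essential suprema
   of H_X(., u) : phi over superlevel sets of H(., u), which decrease to their
   infimum as the level rises. This is Penot differentiability; a path c with
   derivative phi at 0^+ is u + t psi(t) with psi(t) -> phi, so Hadamard
   differentiability follows, and the calculus rules compose such paths. *)
Require Import Defs.
From HB Require Import structures.
From mathcomp Require Import all_boot all_order all_algebra.
From mathcomp Require Import all_classical all_reals all_analysis.
From mathcomp Require Import measurable_realfun ess_sup_inf.
From mathcomp Require Import lra.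
Import Order.TTheory GRing.Theory Num.Theory.
Import numFieldNormedType.Exports.
Local Open Scope classical_set_scope.
Local Open Scope ring_scope.

(** * Density, Riesz representation and Taylor expansion in the space of jets *)

Section jet_space.
Context {R : realType} {n k N : nat}.
Local Notation jet := (jet R n k N).
Local Notation jet_index := (jet_index n k N).

Lemma jetP (X Y : jet) : (forall a, X a = Y a) -> X = Y.
Proof. by move=> XY; apply/val_inj/ffunP. Qed.

Lemma jet_perm (X : jet) (j : 'I_k.+1) (i : 'I_N) (s t : j.-tuple 'I_n) :
  perm_eq s t -> X (jidx i s) = X (jidx i t).
Proof. by move=> st; have /jet_symmetricP := valP X; exact. Qed.

Lemma jet_sumE (I : finType) (F : I -> jet) a :
  (\sum_i F i) a = \sum_i F i a.
Proof.
elim/big_rec2 : _ => [|i y X _ <-]; first exact: jet0E.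
exact: jetDE.
Qed.

Lemma jet_dotBl (X Y Z : jet) : jet_dot (X - Y) Z = jet_dot X Z - jet_dot Y Z.
Proof. by rewrite -(scaleN1r Y) jet_dotDl jet_dotZl mulN1r. Qed.

Lemma jet_dotBr (X Y Z : jet) : jet_dot Z (X - Y) = jet_dot Z X - jet_dot Z Y.
Proof. by rewrite !(jet_dotC Z) jet_dotBl. Qed.

Lemma jet_dot_norm_le (X Y : jet) : `|jet_dot X Y| <= `|X| * `|Y|.
Proof.
rewrite ler_norml jet_dot_le andbT lerNl -mulN1r -jet_dotZl.
by rewrite (le_trans (jet_dot_le _ _))// [jet_norm (_ *: _)]jet_normZ normrN1 mul1r.
Qed.

(** With $d$ indices the sum of squares is at most $d c^2\le((d+1)c)^2$; this crude constant
    suffices for a density argument. *)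
Lemma jet_norm_le_coord (X : jet) c : 0 <= c -> (forall a, `|X a| <= c) ->
  `|X| <= #|{: jet_index}|.+1%:R * c.
Proof.
move=> c0 Xc; rewrite -ler_sqr ?nnegrE ?mulr_ge0//.
rewrite -[`|X|]/(jet_norm X) jet_norm_sqr.
apply: (@le_trans _ _ (\sum_(a : jet_index) c ^+ 2)).
  apply: ler_sum => a _.
  by rewrite -expr2 -real_normK ?num_real// lerXn2r ?nnegrE.
rewrite sumr_const -[leLHS]mulr_natl exprMn ler_wpM2r ?sqr_ge0//.
by rewrite -natrX ler_nat -mulnn (leq_trans (leqnSn _))// leq_pmulr.
Qed.

(** Rational grid points are countable, and rounding down coordinate by coordinate keeps equal
    entries equal, so the approximation of a symmetric tensor stays symmetric. *)
Lemma jet_dense_seq : exists D : nat -> jet,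
  forall (X : jet) (P : set jet), nbhs X P -> exists m, P (D m).
Proof.
pose grid (q : nat) (z : {ffun jet_index -> int}) : {ffun jet_index -> R} :=
  [ffun a => (z a)%:~R / q.+1%:R].
(* Codes that decode to nothing and grid points that are not symmetric are sent to 0. *)
pose D (m : nat) : jet :=
  if unpickle m is Some (q, z) then
    insubd (0 : jet) (grid q z) else 0.
exists D => X P /nbhs_ballP[e /= e0 eP].
pose c := #|{: jet_index}|.+1%:R : R.
have c0 : 0 < c by rewrite ltr0n.
pose q := Num.truncn (c / e).
have q0 : 0 < q.+1%:R :> R by rewrite ltr0n.
pose z : {ffun jet_index -> int} := [ffun a => Num.floor (X a * q.+1%:R)].
exists (pickle (q, z)); apply: eP; rewrite -ball_normE /ball_ /=.
rewrite /D pickleK.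
set F := grid _ _.
have FE a : F a = (Num.floor (X a * q.+1%:R))%:~R / q.+1%:R by rewrite !ffunE.
have sF : F \in @jet_symmetric R n k N.
  apply/jet_symmetricP => j i s t st; rewrite !FE.
  by rewrite (jet_perm X _ _ _ _ st).
have vE a : (insubd (0 : jet) F) a = F a.
  by rewrite -[LHS]/(val (insubd (0 : jet) F) a) insubdK.
have qe : c / q.+1%:R < e.
  by rewrite ltr_pdivrMr// mulrC -ltr_pdivrMr//; exact: truncnS_gt.
apply: le_lt_trans qe; apply: jet_norm_le_coord; first by rewrite invr_ge0 ltW.
move=> a; rewrite jetDE -scaleN1r jetZE vE FE mulN1r.
rewrite -[X in `|X - _|](mulfK (lt0r_neq0 q0)) -mulrBl normrM [`|_^-1|]gtr0_norm ?invr_gt0//.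
apply: ler_piMl; first by rewrite invr_ge0 ltW.
rewrite ger0_norm ?subr_ge0 ?floor_le//.
by rewrite lerBlDl ltW// -[X in _ + X]/(1%:~R) -intrD floorD1_gt.
Qed.

(* For each index a, I a is the indicator of the orbit of a under permutations of
   the derivative word and m a the size of that orbit; a symmetric F is then
   [\sum_a (F a / m a) *: I a], so that l is represented by [l (I a) / m a]. *)
Lemma jet_riesz (l : {linear jet -> R}) :
  exists G, forall F, l F = jet_dot G F.
Proof.
(* Sorting the word gives a complete invariant of the orbit. *)
pose key (a : jet_index) := (tag a, (tagged a).1, sort leq (map val (tagged a).2)).
pose same a b := key a == key b.
have key_perm (j : 'I_k.+1) i (s t : j.-tuple 'I_n) : perm_eq s t ->
    key (jidx i s) = key (jidx i t).
  move=> st; congr (_, _, _) => /=; apply/perm_sortP.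
  - exact: leq_total.
  - exact: leq_trans.
  - exact: anti_leq.
  - exact: perm_map.
have Isym c : [ffun a => (same c a)%:R : R] \in @jet_symmetric R n k N.
  by apply/jet_symmetricP => j i s t st; rewrite !ffunE /same (key_perm _ _ _ _ st).
pose I c : jet := Jet (Isym c).
have IE c a : I c a = (same c a)%:R by rewrite /I /= ffunE.
pose m (a : jet_index) : R := \sum_b (same a b)%:R.
have m0 a : m a != 0.
  rewrite gt_eqF// /m (bigD1 a)//= /same eqxx ltr_pwDl//.
  by apply: sumr_ge0.
have same_sym a b : same a b = same b a by rewrite /same eq_sym.
have same_eq a b : same a b -> forall X : jet, X a = X b.
  case: a b => [j [i s]] [j' [i' t]] /eqP[ej ei est] X; subst j' i'.
  apply: (jet_perm X); apply: (perm_map_inj val_inj).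
  by apply/perm_sortP; [exact: leq_total|exact: leq_trans|exact: anti_leq|].
have same_I a b : same a b -> I a = I b.
  by move=> /eqP ab; apply: jetP => c; rewrite !IE /same ab.
have same_m a b : same a b -> m a = m b.
  by move=> /eqP ab; rewrite /m /same ab.
have Gsym : [ffun a => l (I a) / m a] \in @jet_symmetric R n k N.
  apply/jet_symmetricP => j i s t st; rewrite !ffunE.
  have ss : same (jidx i s) (jidx i t) by apply/eqP/key_perm.
  by rewrite (same_m _ _ ss) (same_I _ _ ss).
exists (Jet Gsym) => F.
have FE : F = \sum_a (F a / m a) *: I a.
  apply: jetP => b; rewrite jet_sumE.
  transitivity (\sum_a F b / m b * (same b a)%:R).
    by rewrite -mulr_sumr divfK.
  apply: eq_bigr => a _; rewrite jetZE IE same_sym.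
  case: (boolP (same a b)) => [ab|_]; last by rewrite !mulr0.
  by rewrite (same_m _ _ ab) (same_eq _ _ ab).
rewrite [in LHS]FE linear_sum jet_dotC.
apply: eq_bigr => a _; rewrite linearZ /= ffunE /=.
by rewrite -[LHS]/(F a / m a * l (I a)) mulrAC mulrA.
Qed.

(** ['d h X] is a linear form by construction, so a representing jet exists and the default value in
    [gradient] is never taken. *)
Lemma gradientE (h : jet -> R) X F :
  'd h X F = jet_dot (gradient h X) F.
Proof.
have [G hG] := jet_riesz ('d h X).
by rewrite /gradient; case: xgetP => [G' _ /(_ F)//|/(_ G)].
Qed.

Lemma C1_mean_value (h : jet -> R) X F t : C1 h -> 0 < t ->
  exists2 s, 0 < s < t & h (X + t *: F) - h X = t * jet_dot (gradient h (X + s *: F)) F.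
Proof.
move=> [dh _] t0.
have dg (s : R) : is_derive s 1 (fun s => h (X + s *: F))
    (jet_dot (gradient h (X + s *: F)) F).
  have e : (fun r : R => r^-1 *: (h (X + (r *: 1 + s) *: F) - h (X + s *: F))) =
      (fun r : R => r^-1 *: (h (r *: F + (X + s *: F)) - h (X + s *: F))).
    apply/funext => r; congr (_ *: (h _ - _)).
    by rewrite -[r *: 1]/(r * 1) mulr1 scalerDl addrCA.
  have dF := @diff_derivable _ _ _ h _ F (dh (X + s *: F)).
  apply: DeriveDef; first by rewrite /derivable /= e.
  by rewrite /derive /= e -[LHS]/('D_F h (X + s *: F)) deriveE// gradientE.
have [|s /[!in_itv]/= st] := MVT t0 (fun s _ => dg s).
  apply: continuous_subspaceT => s; apply: differentiable_continuous.
  by apply/derivable1_diffP; case: (dg s).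
by rewrite subr0 scale0r addr0 mulrC => e; exists s.
Qed.

(** For a gradient $G'$ on the segment, $G':F_2-G:F_1=(G'-G):F_2+G:(F_2-F_1)$ gives the two error
    terms. Two directions occur because the Penot limit lets the direction vary with [t]. *)
Lemma C1_expansion (h : jet -> R) X F1 F2 t eps : C1 h -> 0 < t ->
  (forall s, 0 < s < t -> `|gradient h (X + s *: F2) - gradient h X| <= eps) ->
  `|h (X + t *: F2) - h X - t * jet_dot (gradient h X) F1| <=
    t * (eps * `|F2| + `|gradient h X| * `|F2 - F1|).
Proof.
move=> C1h t0 he; have [s st ->] := C1_mean_value h X F2 t C1h t0.
rewrite -mulrBr normrM (gtr0_norm t0) ler_pM2l//; move: (he s st).
move: (gradient h _) (gradient h X) => G' G hG.
have -> : jet_dot G' F2 - jet_dot G F1 = jet_dot (G' - G) F2 + jet_dot G (F2 - F1).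
  by rewrite jet_dotBl jet_dotBr addrA subrK.
rewrite (le_trans (ler_normD _ _))// lerD// (le_trans (jet_dot_norm_le _ _))//.
by rewrite ler_wpM2r.
Qed.

End jet_space.

(** * Nonempty open sets are not Lebesgue null *)

Section lebesgue_open.
Context {R : realType}.
Local Notation nu := (tuple_measure (@lebesgue_measure R)).

(** By induction on the dimension: a box is an interval times a lower box, and in dimension 0 the
    measure is a unit mass. *)
Lemma tuple_measure_box n (x : 'I_n -> R) (e : R) : 0 < e ->
  let B := [set t : n.-tuple (measurableTypeR R) | forall i, ball (x i) e (tnth t i)] in
  measurable B /\ (0 < nu n B)%E.
Proof.
move=> e0; elim: n x => [|n IH] x /=.
  rewrite (_ : [set t | _] = setT); last by apply/seteqP; split=> // t _ [].
  by split; [exact: measurableT|rewrite diracT lte01].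
have [mB B0] := IH (fun i => x (lift ord0 i)).
set B := [set t | _] in mB B0; set A := [set t | _].
have AE : A = tuple_uncons (n:=n) @^-1` (ball (x ord0) e `*` B).
  have beheadK (y : R) (t : n.-tuple R) : [tuple of behead [tuple of y :: t]] = t.
    exact: val_inj.
  apply/seteqP; split=> t; case/tupleP: t => y t; rewrite /A /B /= theadE beheadK.
    move=> h; split=> [|i]; first by rewrite -(tnth0 y t); exact: h.
    by rewrite -(tnthS y t i); exact: h.
  move=> [h0 h] i; case: (fintype.unliftP ord0 i) => [j ->|->]; last first.
    by rewrite (tnth0 y t).
  by rewrite (tnthS y t j); exact: h.
have mb : measurable (ball (x ord0) e : set (measurableTypeR R)) by exact: measurable_ball.
split.
  rewrite AE -[X in measurable X]setTI; apply: measurable_tuple_uncons => //.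
  exact: measurableX.
rewrite /tuple_measure_step /pushforward AE -comp_preimage.
rewrite (_ : _ \o _ = id) ?preimage_id; last first.
  by apply/funext => p /=; rewrite tuple_consK.
rewrite product_measure1E//; apply: mule_gt0 => //.
have := lebesgue_measure_ball (x ord0) (ltW e0) => bE.
apply: (@lt_le_trans _ _ (e *+ 2)%:E); first by rewrite lte_fin mulrn_wgt0.
by rewrite -bE.
Qed.

Lemma lebesgue_open_not_negligible n (Omega : set 'rV[R]_n) :
  open Omega -> Omega !=set0 -> ~ (\forall x \ae lebesgue n, ~ Omega x).
Proof.
move=> oO [x Ox] [A [mA A0 OA]].
have {}OA : Omega `<=` A by move=> y Oy; apply: OA => /=; exact.
have /nbhs_ballP[e /= e0 eO] := open_nbhs_nbhs (conj oO Ox).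
have [mB] := tuple_measure_box n (x ord0) e e0.
set B := [set t | _] in mB *.
(* On the measurable box the outer measure agrees with the product measure, so monotonicity
   contradicts the nullity of [A]. *)
rewrite -(measurable_mu_extE (nu n) mB) => B0.
suff : (mu_ext (nu n) B <= lebesgue_outer A)%E.
  by rewrite leNgt -[lebesgue_outer A]/(lebesgue n A) A0 B0.
apply: le_mu_ext => t /= Bt; apply: OA; apply: eO; split=> // i j.
by rewrite !ord1 mxE.
Qed.

End lebesgue_open.

(** * Essential suprema and essentially uniform moduli of continuity *)

Section essential_bounds.
Context {R : realType} {n : nat}.
Local Notation mu := (@lebesgue R n).

Lemma ess_sup_on_ler (A : set 'rV[R]_n) (f : 'rV[R]_n -> R) (y : R) :
  (ess_sup_on A f <= y%:E)%E <-> \forall x \ae mu, A x -> f x <= y.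
Proof.
rewrite ess_sup_onP; split=> h; apply: filterS h => x h Ax.
  by rewrite -lee_fin h.
by rewrite lee_fin h.
Qed.

(** The value $-\infty$ would make [A] negligible, and the bound excludes $+\infty$. *)
Lemma ess_sup_on_fin_num (A : set 'rV[R]_n) (f : 'rV[R]_n -> R) M :
  ~ (\forall x \ae mu, ~ A x) -> (\forall x \ae mu, A x -> `|f x| <= M) ->
  ess_sup_on A f \is a fin_num.
Proof.
move=> A0 fM; rewrite fin_numE; apply/andP; split.
  apply/eqP => fNy; apply: A0.
  have /ess_sup_onP : (ess_sup_on A f <= -oo)%E by rewrite fNy.
  by apply: filterS => x + Ax => /(_ Ax); rewrite leeNy_eq.
rewrite -ltey; apply/ess_sup_on_ltyP; exists M; apply: filterS fM => x fM Ax.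
exact: le_trans (ler_norm _) (fM Ax).
Qed.

Lemma fine_ess_sup_onP (A : set 'rV[R]_n) (f : 'rV[R]_n -> R) (y : R) :
  ess_sup_on A f \is a fin_num ->
  fine (ess_sup_on A f) <= y <-> \forall x \ae mu, A x -> f x <= y.
Proof. by move=> fA; rewrite -ess_sup_on_ler -lee_fin fineK. Qed.

Section modulus.
Context {k N : nat} {V : normedModType R}.
Variables (Omega : set 'rV[R]_n) (g : 'rV[R]_n -> jet R n k N -> V).
Local Notation jet := (jet R n k N).

(** Distinct jets only, since a modulus on $]0,+\infty[$ says nothing about [omega 0]. The target
    [V] is general in order to cover both the integrand and its gradient. *)
Definition ess_modulus (r : R) (omega : R -> R) := forall X1 X2 : jet,
  `|X1| < r -> `|X2| < r -> X1 <> X2 ->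
  (ess_sup_on Omega (fun x => `|g x X2 - g x X1|%R) <= (omega `|X2 - X1|%R)%:E)%E.

Hypothesis g_cont : \forall x \ae mu, Omega x -> continuous (g x).

(* The exceptional null set of [ess_modulus] depends on the pair of jets; a
   countable dense set of jets and continuity make it uniform. *)
Lemma ess_modulus_uniform r omega : ess_modulus r omega ->
  \forall x \ae mu, Omega x -> forall (d e : R) (X1 X2 : jet),
    0 <= e -> (forall t, 0 < t < d -> omega t <= e) ->
    `|X1| < r -> `|X2| < r -> `|X2 - X1| < d -> `|g x X2 - g x X1| <= e.
Proof.
move=> g_mod; have [D D_dense] := @jet_dense_seq R n k N.
have : \forall x \ae mu, forall i j, `|D i| < r -> `|D j| < r -> D i <> D j ->
    Omega x -> `|g x (D j) - g x (D i)| <= omega `|D j - D i|.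
  apply: ae_foralln => i; apply: ae_foralln => j.
  have [Di|] := boolP (`|D i| < r); last by move=> _; exact: aeW.
  have [Dj|] := boolP (`|D j| < r); last by move=> _; exact: aeW.
  have [Dij|/eqP Dij] := eqVneq (D i) (D j); first exact: aeW.
  have /ess_sup_on_ler := g_mod _ _ Di Dj Dij.
  by apply: filterS => x h _ _ _; exact: h.
apply: filterS2 g_cont => x gc gD Ox d e X1 X2 e0 de X1r X2r X12.
have {}gc := gc Ox.
rewrite leNgt; apply/negP => eg.
(* [eta] is the slack in the distance and [zeta] the supposed excess over [e]; each endpoint may use
   half of both when replaced by a point of the dense sequence. *)
set eta := d - `|X2 - X1|; have eta0 : 0 < eta by rewrite subr_gt0.
set zeta := `|g x X2 - g x X1| - e; have zeta0 : 0 < zeta by rewrite subr_gt0.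
have near_data (X : jet) : `|X| < r ->
    exists m, [/\ `|D m| < r, `|X - D m| < eta / 2 & `|g x X - g x (D m)| < zeta / 2].
  move=> Xr; apply: (D_dense X [set Y | [/\ `|Y| < r, `|X - Y| < eta / 2 &
    `|g x X - g x Y| < zeta / 2]]).
  near=> Y; split.
  - by near: Y; apply: (cvgr_norm_lt X) => //; exact: cvg_id.
  - by near: Y; apply: cvgr_dist_lt; [exact: cvg_id|exact: divr_gt0].
  - by near: Y; apply: cvgr_dist_lt; [exact: gc|exact: divr_gt0].
have [i [Di Xi gi]] := near_data _ X1r; have [j [Dj Xj gj]] := near_data _ X2r.
have Dij : `|D j - D i| < d.
  have -> : D j - D i = (X2 - X1) + (X1 - D i) - (X2 - D j).
    by rewrite addrA subrK opprB [RHS]addrC subrKA.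
  apply: le_lt_trans (ler_normB _ _) _; have := ler_normD (X2 - X1) (X1 - D i).
  move: Xi Xj; rewrite /eta; lra.
have gDij : `|g x (D j) - g x (D i)| <= e.
  have [DE|/eqP DE] := eqVneq (D i) (D j); first by rewrite DE subrr normr0.
  apply: le_trans (gD _ _ Di Dj DE Ox) (de _ _); rewrite Dij andbT.
  by rewrite normr_gt0 subr_eq0 eq_sym; exact/eqP.
have : `|g x X2 - g x X1| < zeta + e.
  have -> : g x X2 - g x X1 = (g x X2 - g x (D j)) + (g x (D j) - g x (D i)) - (g x X1 - g x (D i)).
    by rewrite subrKA opprB subrKA.
  apply: le_lt_trans (ler_normB _ _) _.
  have := ler_normD (g x X2 - g x (D j)) (g x (D j) - g x (D i)); lra.
by rewrite /zeta subrK ltxx.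
Unshelve. all: by end_near.
Qed.

Definition ess_uniform := forall r : R, 0 < r -> exists omega : R -> R,
  [/\ {in `]0, +oo[ &, {homo omega : s t / s <= t}},
      omega t @[t --> 0^'+] --> 0 & ess_modulus r omega].

Hypothesis g_unif : ess_uniform.

(** As [omega] tends to 0 at $0^+$, it is at most [e] on some $]0,d[$; the uniform form of the
    modulus then applies off a single null set. *)
Lemma ess_uniform_equicont (r e : R) : 0 < r -> 0 < e -> exists2 d : R, 0 < d &
  \forall x \ae mu, Omega x -> forall X1 X2 : jet,
    `|X1| < r -> `|X2| < r -> `|X2 - X1| < d -> `|g x X2 - g x X1| <= e.
Proof.
move=> r0 e0; have [omega [_ omega0 g_mod]] := g_unif r r0.
have /cvgr0_norm_lt/(_ e e0) := omega0; rewrite near_withinE.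
move=> /nbhs_ballP[d /= d0 de]; exists d => //.
apply: filterS (ess_modulus_uniform _ _ g_mod) => x h Ox X1 X2.
apply: (h Ox d e); [exact: ltW|move=> t /andP[t0 td]].
apply: le_trans (ler_norm _) (ltW _); apply: de => //=.
by rewrite -ball_normE /ball_ /= sub0r normrN gtr0_norm.
Qed.

(** A jet in the ball is at distance less than [r] from 0, so by monotonicity [omega r] bounds the
    deviation from the value at 0. *)
Lemma ess_uniform_bounded (r : R) :
  (ess_sup_on Omega (fun x => `|g x 0%R|%R) < +oo)%E -> 0 < r -> exists2 M : R, 0 <= M &
  \forall x \ae mu, Omega x -> forall X : jet, `|X| < r -> `|g x X| <= M.
Proof.
move=> /ess_sup_on_ltyP[M0 gM0] r0; have [omega [omega_le _ g_mod]] := g_unif r r0.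
exists (`|M0| + `|omega r|); first by rewrite addr_ge0.
apply: filterS2 gM0 (ess_modulus_uniform _ _ g_mod) => x gM0 h Ox X Xr.
have gX : `|g x X - g x 0| <= `|omega r|.
  apply: (h Ox r) => //; rewrite ?normr0 ?subr0// => t /andP[t0 tr].
  by apply: le_trans (ler_norm _); apply: omega_le; rewrite ?in_itv/= ?andbT// ltW.
have -> : g x X = g x 0 + (g x X - g x 0) by rewrite addrC subrK.
apply: le_trans (ler_normD _ _) _; rewrite lerD//.
exact: le_trans (gM0 Ox) (ler_norm _).
Qed.

End modulus.
End essential_bounds.

(** * Calculus of Penot and Hadamard semi-differentials *)

Section semidifferential_calculus.
Context {R : realType} {X Y : normedModType R}.

(** A path is $c(t)=u+t\psi(t)$ with $\psi(t)=(c(t)-u)/t\to\phi$, so the joint limit contains the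
    limit along every path; constant $\psi$ identifies [l] with the semi-differential. *)
Lemma penot_semidiff_cvg (f : X -> Y) u phi l :
  (fun p : R * X => p.1^-1 *: (f (u + p.1 *: p.2) - f u))
    @ filter_prod (0 : R)^'+ (nbhs phi) --> l ->
  [/\ semidiff f u phi = l, penot_semidiff f u phi & hadamard_semidiff f u phi].
Proof.
move=> fl.
have path_cvg (psi : R -> X) : psi @ 0^'+ --> phi ->
    (fun t => t^-1 *: (f (u + t *: psi t) - f u)) @ 0^'+ --> l.
  move=> psi_phi.
  pose h (t : R) (v : X) := t^-1 *: (f (u + t *: v) - f u).
  exact: (@cvg_comp2 _ _ _ _ _ _ _ _ _ _ _ id psi h cvg_id psi_phi fl).
have e : semidiff f u phi = l.
  by apply/cvg_lim => //; apply: (path_cvg (cst phi)); exact: cvg_cst.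
split=> //; first by rewrite /penot_semidiff e.
move=> c c0 /path_cvg cl; rewrite e; apply: cvg_trans cl; apply: near_eq_cvg.
apply: filterS (nbhs_right_neq 0) => t t0.
by rewrite c0 scalerA divff// scale1r subrKC.
Qed.

Lemma hadamard_semidiff_line (f : X -> Y) u phi : hadamard_semidiff f u phi ->
  (fun t : R => t^-1 *: (f (u + t *: phi) - f u)) @ 0^'+ --> semidiff f u phi.
Proof.
move=> hf; have := hf (fun t => u + t *: phi); rewrite /= scale0r addr0; apply=> //.
have e : {near (0 : R)^'+, cst phi =1 (fun t : R => t^-1 *: (u + t *: phi - u))}.
  apply: filterS (nbhs_right_neq 0) => t t0.
  by rewrite addrAC subrr add0r scalerA mulVf// scale1r.
by apply: (cvg_trans (near_eq_cvg e)); exact: cvg_cst.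
Qed.

Lemma semidiff_unique (f : X -> Y) u phi l :
  (fun t : R => t^-1 *: (f (u + t *: phi) - f u)) @ 0^'+ --> l ->
  semidiff f u phi = l.
Proof. exact: cvg_lim. Qed.

Lemma hadamard_semidiff_linear (f g : X -> Y) (a b : R) u phi :
  hadamard_semidiff f u phi -> hadamard_semidiff g u phi ->
  hadamard_semidiff (fun w => a *: f w + b *: g w) u phi /\
  semidiff (fun w => a *: f w + b *: g w) u phi =
    a *: semidiff f u phi + b *: semidiff g u phi.
Proof.
move=> hf hg.
have quotE (v w : X) (t : R) : t^-1 *: (a *: f v + b *: g v - (a *: f w + b *: g w)) =
    a *: (t^-1 *: (f v - f w)) + b *: (t^-1 *: (g v - g w)).
  rewrite !scalerA ![_ * t^-1]mulrC -!scalerA -scalerDr; congr (_ *: _).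
  by rewrite !scalerBr opprD addrACA.
have sd : semidiff (fun w => a *: f w + b *: g w) u phi =
    a *: semidiff f u phi + b *: semidiff g u phi.
  apply: semidiff_unique; under eq_fun do rewrite quotE.
  by apply: cvgD; apply: cvgZr; exact: hadamard_semidiff_line.
split=> // c c0 cphi; rewrite sd; under eq_fun do rewrite quotE.
by apply: cvgD; apply: cvgZr; [exact: hf|exact: hg].
Qed.

End semidifferential_calculus.

(** Hadamard semi-differentiability of [f] says that $f\circ c$ is again an admissible path, with
    right derivative [semidiff f u phi]; [G] is tested on it. *)
Lemma hadamard_semidiff_comp {R : realType} {X Y Z : normedModType R}
    (f : X -> Y) (G : Y -> Z) u phi :
  hadamard_semidiff f u phi -> hadamard_semidiff G (f u) (semidiff f u phi) ->
  hadamard_semidiff (G \o f) u phi /\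
  semidiff (G \o f) u phi = semidiff G (f u) (semidiff f u phi).
Proof.
move=> hf hG.
have sd : semidiff (G \o f) u phi = semidiff G (f u) (semidiff f u phi).
  apply: semidiff_unique.
  have := hG (fun t => f (u + t *: phi)); rewrite scale0r addr0; apply=> //.
  exact: hadamard_semidiff_line.
split=> // c c0 cphi; rewrite sd; apply: (hG (f \o c)) => /=; first by rewrite c0.
exact: hf.
Qed.

(** * First variation of the supremal functional *)

Section supremal_functional.
Context {R : realType} {n k N : nat}.
Local Notation mu := (@lebesgue R n).
Variables (Omega : set 'rV[R]_n) (H : 'rV[R]_n -> jet R n k N -> R).
Local Notation W := (sobolev k N Omega).
Local Notation E := (@supremal R n k N Omega H).

Lemma Dvec_lt_norm (u : W) r : `|u| < r -> \forall x \ae mu, Omega x -> `|Dvec u x| < r.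
Proof.
by move=> ur; apply: filterS (Dvec_le_norm u) => x + Ox => /(_ Ox) /le_lt_trans; exact.
Qed.

Hypothesis Omega_ae : ~ (\forall x \ae mu, ~ Omega x).
Hypothesis H_C1 : \forall x \ae mu, Omega x -> C1 (H x).
Hypothesis H_cont : \forall x \ae mu, Omega x -> continuous (H x).
Hypothesis H_unif : ess_uniform Omega H.
Hypothesis DH_unif : ess_uniform Omega (fun x => gradient (H x)).
Hypothesis H_0 : (ess_sup_on Omega (fun x => `|H x 0|%R) < +oo)%E.
Hypothesis DH_0 : (ess_sup_on Omega (fun x => `|gradient (H x) 0|%R) < +oo)%E.

Lemma gradient_cont : \forall x \ae mu, Omega x -> continuous (gradient (H x)).
Proof. by apply: filterS H_C1 => x + Ox => /(_ Ox)[]. Qed.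

Lemma ereal_supremal_fin_num (u : W) : ereal_supremal H u \is a fin_num.
Proof.
(* The extra 1 places the jets of [u] strictly inside the open ball. *)
have r0 : 0 < `|u| + 1 by rewrite ltr_wpDl.
have [M _ HM] := ess_uniform_bounded _ _ H_cont H_unif _ H_0 r0.
apply: (ess_sup_on_fin_num _ _ M Omega_ae).
have u1 : `|u| < `|u| + 1 by rewrite ltrDl.
by apply: filterS2 HM (Dvec_lt_norm u _ u1) => x HM ux Ox; exact/HM/ux.
Qed.

Lemma supremal_leP (u : W) y :
  E u <= y <-> \forall x \ae mu, Omega x -> H x (Dvec u x) <= y.
Proof. exact/fine_ess_sup_onP/ereal_supremal_fin_num. Qed.

Section variation.
Variables u phi : W.
Local Notation dH x := (jet_dot (gradient (H x) (Dvec u x)) (Dvec phi x)).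
Local Notation L eps := (fine (ess_sup_superlevel H u phi eps)).

Lemma variation_bounded : exists2 B, 0 <= B &
  \forall x \ae mu, Omega x -> `|dH x| <= B.
Proof.
have r0 : 0 < `|u| + 1 by rewrite ltr_wpDl.
have [M M0 HM] := ess_uniform_bounded _ _ gradient_cont DH_unif _ DH_0 r0.
exists (M * `|phi|); first by rewrite mulr_ge0.
have u1 : `|u| < `|u| + 1 by rewrite ltrDl.
apply: filterS3 HM (Dvec_lt_norm u _ u1) (Dvec_le_norm phi) => x HM ux px Ox.
by apply: le_trans (jet_dot_norm_le _ _) _; apply: ler_pM => //; [exact/HM/ux|exact: px].
Qed.

(** Otherwise [E u - eps] would be an essential upper bound below the essential supremum. *)
Lemma superlevel_not_negligible eps : 0 < eps ->
  ~ (\forall x \ae mu, ~ (Omega x /\ H x (Dvec u x) >= E u - eps)).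
Proof.
move=> eps0 h; suff : E u <= E u - eps by move: (E u) eps0 => y; lra.
apply/supremal_leP; apply: filterS h => x h Ox.
by rewrite leNgt; apply/negP => /ltW ?; exact: h.
Qed.

Lemma superlevel_fin_num eps : 0 < eps ->
  ess_sup_superlevel H u phi eps \is a fin_num.
Proof.
move=> eps0; have [B _ bB] := variation_bounded.
apply: (ess_sup_on_fin_num _ _ B (superlevel_not_negligible _ eps0)).
by apply: filterS bB => x bB [Ox _]; exact: bB.
Qed.

Lemma superlevel_leP eps y : 0 < eps -> L eps <= y <->
  \forall x \ae mu, Omega x -> E u - eps <= H x (Dvec u x) -> dH x <= y.
Proof.
move=> eps0; rewrite /ess_sup_superlevel fine_ess_sup_onP ?superlevel_fin_num//.
split=> h; apply: filterS h => x h; last by case; exact: h.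
by move=> Ox Ex; apply: h.
Qed.

Lemma superlevel_le eps1 eps2 : 0 < eps1 -> eps1 <= eps2 -> L eps1 <= L eps2.
Proof.
move=> eps0 eps12; apply/superlevel_leP => //.
have /superlevel_leP : L eps2 <= L eps2 by [].
move=> /(_ (lt_le_trans eps0 eps12)); apply: filterS => x h Ox Ex.
by apply: h => //; apply: le_trans Ex; rewrite lerD2l lerN2.
Qed.

(** The threshold [d] serves all admissible [t] and [psi]. Half of [e] pays for the oscillation of
    the gradient, half for the change of direction. *)
Lemma supremal_expansion e : 0 < e -> exists2 d, 0 < d & forall (t : R) (psi : W),
  0 < t < d -> `|psi - phi| < d -> \forall x \ae mu, Omega x ->
  `|H x (Dvec (u + t *: psi) x) - H x (Dvec u x) - t * dH x| <= t * e.
Proof.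
move=> e0; pose p1 := `|phi| + 1; have p0 : 0 < p1 by rewrite ltr_wpDl.
pose r := `|u| + p1 + 1; have r0 : 0 < r by rewrite ltr_wpDl// addr_ge0// ltW.
have [M M0 DM] := ess_uniform_bounded _ _ gradient_cont DH_unif _ DH_0 r0.
have e'0 : 0 < e / 2 / p1 by rewrite !divr_gt0.
have [d' d'0 Dd] := ess_uniform_equicont _ _ gradient_cont DH_unif _ _ r0 e'0.
have M1 : 0 < M + 1 by rewrite ltr_wpDl.
(* The bound 1 keeps $|\psi|\le p_1$ and the segments inside the ball of radius [r]; the second
   makes the segments shorter than [d']; the third controls $|\psi-\phi|$, with [M + 1] to avoid
   dividing by 0. *)
exists (Num.min 1 (Num.min (d' / p1) (e / 2 / (M + 1)))).
  by rewrite !lt_min ltr01 !divr_gt0.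
move=> t psi; rewrite !lt_min => /and4P[t0 t1 td _] /and3P[pp _ pe].
have psi_le : `|psi| <= p1.
  by rewrite -[psi](subrK phi) addrC (le_trans (ler_normD _ _))// lerD2l ltW.
(* [Dvec] picks representatives, hence is additive only almost everywhere. *)
have psiE := DvecD phi (psi - phi); rewrite subrKC in psiE.
have jetsE : \forall x \ae mu, Omega x ->
    Dvec (u + t *: psi) x = Dvec u x + t *: Dvec psi x /\
    `|Dvec psi x - Dvec phi x| <= e / 2 / (M + 1).
  apply: filterS3 (filterI (DvecD u (t *: psi)) (DvecZ t psi)) psiE (Dvec_le_norm (psi - phi)).
  move=> x [/= uE tE] pE pN Ox; rewrite uE// tE// pE// addrAC subrr add0r; split=> //.
  exact: le_trans (pN Ox) (ltW pe).
have norms : \forall x \ae mu, Omega x -> `|Dvec u x| <= `|u| /\ `|Dvec psi x| <= p1.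
  apply: filterS2 (Dvec_le_norm u) (Dvec_le_norm psi) => x ux px Ox.
  by split; [exact: ux|exact: le_trans (px Ox) psi_le].
apply: filterS3 (filterI DM Dd) (filterI jetsE norms) H_C1.
move=> x [/= DMx Ddx] [/= jx nx] C1x Ox.
have [-> pE] := jx Ox; have [ux px] := nx Ox.
have ur : `|Dvec u x| < r by rewrite (le_lt_trans ux)// /r -addrA ltrDl ltr_wpDl// ltW.
have sp s : 0 < s < t -> `|s *: Dvec psi x| <= s * p1.
  by case/andP=> s0 _; rewrite normrZ gtr0_norm// ler_pM2l.
have gradE s : 0 < s < t ->
    `|gradient (H x) (Dvec u x + s *: Dvec psi x) - gradient (H x) (Dvec u x)| <= e / 2 / p1.
  move=> st; have /andP[s0 s_t] := st; apply: Ddx => //.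
    apply: le_lt_trans (ler_normD _ _) _; rewrite /r -addrA; apply: ler_ltD => //.
    apply: le_lt_trans (sp _ st) _; rewrite -[X in X < _]mul1r ltr_pwDr//.
    by rewrite mul1r ler_piMl ?ltW// (lt_trans s_t).
  rewrite addrAC subrr add0r; apply: le_lt_trans (sp _ st) _.
  by rewrite -ltr_pdivlMr// (lt_trans s_t).
apply: le_trans (C1_expansion _ _ (Dvec phi x) _ _ _ (C1x Ox) t0 gradE) _.
rewrite ler_pM2l//.
apply: (@le_trans _ _ (e / 2 / p1 * p1 + (M + 1) * (e / 2 / (M + 1)))); last first.
  by rewrite divfK ?gt_eqF// [(M + 1) * _]mulrC divfK ?gt_eqF// -splitr.
apply: lerD; first by rewrite ler_wpM2l// ltW.
apply: ler_pM => //; apply: le_trans (DMx Ox _ ur) _; by rewrite lerDl.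
Qed.

(* With L the essential supremum of dH over a superlevel set: off
   {H >= E u - eps0} the term t * dH cannot make up for the gap eps0 once t is
   small, whence [E (u + t psi) - E u <= t * (L eps0 + o(1))]; restricting to
   {H >= E u - t * o(1)}, where L is still at least l, gives the lower bound. *)
Lemma supremal_quotient_near e : 0 < e ->
  let l := inf [set L eps | eps in [set eps | 0 < eps]] in
  exists2 d, 0 < d &
    (forall eps, 0 < eps < d -> `|l - L eps| < e) /\
    (forall (t : R) (psi : W), 0 < t < d -> `|psi - phi| < d ->
      `|l - t^-1 *: (E (u + t *: psi) - E u)| < e).
Proof.
move=> e0 l; have [B B0 bB] := variation_bounded.
pose S := [set L eps | eps in [set eps | 0 < eps]].
(* A smaller value would contradict $|dH|\le B$ on a superlevel set that is not null; hence the
   infimum is finite. *)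
have L_ge eps : 0 < eps -> - B <= L eps.
  move=> eps0; rewrite leNgt; apply/negP => LB.
  have /superlevel_leP : L eps <= L eps by [].
  move=> /(_ eps0) Lb; apply: (superlevel_not_negligible _ eps0).
  apply: filterS2 bB Lb => x bB Lb [Ox Ex].
  have := lerNnormlW (bB Ox); rewrite leNgt => /negP; apply.
  exact: le_lt_trans (Lb Ox Ex) LB.
have hS : has_inf S.
  split; first by exists (L 1), 1 => //=.
  by exists (- B) => _ [eps eps0 <-]; exact: L_ge.
have l_le eps : 0 < eps -> l <= L eps.
  by move=> eps0; apply: ge_inf; [exact: hS.2|exists eps].
have e4 : 0 < e / 4 by rewrite divr_gt0.
have [_ [eps0 /= eps00 <-] Leps0] := inf_adherent e4 hS.
have [d d0 Hd] := supremal_expansion _ e4.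
have B21 : 0 < 2 * B + 1 by rewrite ltr_wpDl// mulr_ge0.
(* The last bound gives $2Bt\le eps0$: off the superlevel set $t\,dH\le tB$ while
   $t\,L(eps0)\ge-tB$, and the gap [eps0] covers the difference. *)
exists (Num.min d (Num.min eps0 (eps0 / (2 * B + 1)))).
  by rewrite !lt_min d0 eps00 divr_gt0.
split=> [eps|t psi].
  rewrite !lt_min => /and4P[eps_gt0 _ epseps _].
  rewrite distrC ger0_norm ?subr_ge0 ?l_le// ltrBlDl.
  apply: le_lt_trans (superlevel_le _ _ eps_gt0 (ltW epseps)) _.
  by apply: lt_trans Leps0 _; rewrite ltrD2l; lra.
rewrite !lt_min => /and4P[t0 td _ tB] /andP[pd _].
have {}Hd := Hd t psi (introT andP (conj t0 td)) pd.
set q := _ *: _; have qE : t * q = E (u + t *: psi) - E u.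
  by rewrite /q -[_ *: _]/(_ * _) mulrA divff ?mul1r// gt_eqF.
have tBe : t * (2 * B) <= eps0.
  by move: tB; rewrite ltr_pdivlMr// mulrDr mulr1 => tB; apply: ltW; lra.
have upper : q <= L eps0 + e / 4.
  rewrite -(ler_pM2l t0) qE lerBlDl; apply/supremal_leP.
  have /superlevel_leP : L eps0 <= L eps0 by [].
  move=> /(_ eps00) Lb.
  have /supremal_leP Eu : E u <= E u by [].
  apply: filterS3 (filterI bB Hd) Lb Eu => x [/= bBx Hdx] Lbx Eux Ox.
  have := Hdx Ox; rewrite ler_norml => /andP[_ Hx].
  have := bBx Ox; rewrite ler_norml => /andP[_ bx].
  have EHx := Eux Ox.
  have LB := L_ge _ eps00; have {}Lbx := Lbx Ox.
  move: Hx bx EHx Lbx LB; move: (H x (Dvec _ x)) (H x (Dvec u x)) (dH x) (L eps0) (E u).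
  move=> h' h b0 L0 E0 Hx bx hE Lbx LB.
  have tbB : t * b0 <= t * B by rewrite ler_pM2l.
  have tLB : t * - B <= t * L0 by rewrite ler_pM2l.
  have [/Lbx|Eh] := lerP (E0 - eps0) h; last by lra.
  by rewrite -(ler_pM2l t0); lra.
have lower : l <= q + e / 2.
  (* This level costs $e/4$ in the quotient, and the remainder of the expansion another $e/4$. *)
  have te : 0 < t * (e / 4) by rewrite mulr_gt0.
  apply: le_trans (l_le _ te) _; apply/superlevel_leP => //.
  have /supremal_leP Eu : E (u + t *: psi) <= E (u + t *: psi) by [].
  apply: filterS2 Hd Eu => x Hdx Eux Ox Ex.
  have := Hdx Ox; rewrite ler_norml => /andP[Hx _].
  have EHx := Eux Ox.
  rewrite -(ler_pM2l t0) mulrDr qE (_ : e / 2 = e / 4 + e / 4); last by lra.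
  rewrite mulrDr.
  move: Hx EHx Ex; move: (dH x) (H x (Dvec _ x)) (H x (Dvec u x)) (E u) (E _).
  by move=> b0 h' h E0 E1; lra.
rewrite ltr_distlC; apply/andP; split; first lra.
by apply: le_lt_trans upper _; move: Leps0; rewrite -/l; lra.
Qed.

(** The difference quotients and the superlevel values share the limit [l], which therefore is the
    semi-differential. *)
Lemma supremal_semidiff :
  [/\ hadamard_semidiff E u phi, penot_semidiff E u phi &
      L eps @[eps --> 0^'+] --> semidiff E u phi].
Proof.
set l := inf [set L eps | eps in [set eps | 0 < eps]].
have [|e_l pen had] := penot_semidiff_cvg E u phi l.
  apply/cvgrPdist_lt => e /supremal_quotient_near[d d0 [_ dE]].
  exists ([set t | 0 < t < d], [set psi | `|psi - phi| < d]) => /=; last first.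
    by move=> [t psi] [/= td pd]; exact: dE.
  split.
    apply: filterS2 (nbhs_right_gt 0) (nbhs_right_lt d0) => t t0 td.
    by rewrite /= t0 td.
  by apply/nbhs_ballP; exists d => // psi; rewrite -ball_normE /ball_ /= distrC.
split=> //; rewrite e_l; apply/cvgrPdist_lt => e /supremal_quotient_near[d d0 [dL _]].
apply: filterS2 (nbhs_right_gt 0) (nbhs_right_lt d0) => eps eps0 epsd.
by apply: dL; rewrite eps0 epsd.
Qed.

End variation.
End supremal_functional.

(** * The empty domain and the assembly of the result *)

Lemma ess_sup_on0 {R : realType} {n : nat} (f : 'rV[R]_n -> R) :
  ess_sup_on set0 f = -oo%E.
Proof. by apply/eqP; rewrite -leeNy_eq; apply/ess_sup_onP; exact: aeW. Qed.

Theorem proposition33 (R : realType) (n k N : nat) (Omega : set 'rV[R]_n)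
  (H : 'rV[R]_n -> jet R n k N -> R)
  (Omega_open : open Omega)
  (H_car : caratheodory Omega H)
  (H_C1 : \forall x \ae lebesgue n, Omega x -> C1 (H x))
  (H_unif : forall r : R, 0 < r -> exists omega : R -> R,
    [/\ {in `]0, +oo[, continuous omega},
        {in `]0, +oo[ &, {homo omega : s t / s <= t}},
        omega t @[t --> 0^'+] --> 0 &
        forall X1 X2 : jet R n k N, `|X1| < r -> `|X2| < r -> X1 <> X2 ->
          (ess_sup_on Omega (fun x => `|H x X2 - H x X1|%R)
             <= (omega `|X2 - X1|%R)%:E)%E /\
          (ess_sup_on Omega (fun x => `|gradient (H x) X2 - gradient (H x) X1|%R)
             <= (omega `|X2 - X1|%R)%:E)%E])
  (H_0 : (ess_sup_on Omega (fun x => `|H x 0|%R) < +oo)%E)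
  (HX_0 : (ess_sup_on Omega (fun x => `|gradient (H x) 0|%R) < +oo)%E) :
  let W := sobolev k N Omega in
  let E : W -> R := supremal H in
  [/\ Omega !=set0 -> forall u phi : W, ereal_supremal H u \is a fin_num /\
        forall eps : R, 0 < eps -> ess_sup_superlevel H u phi eps \is a fin_num,
      forall u phi : W,
        [/\ hadamard_semidiff E u phi,
            penot_semidiff E u phi &
            fine (ess_sup_superlevel H u phi eps) @[eps --> 0^'+]
              --> semidiff E u phi],
      forall (u phi : W) (f g : W -> R) (a b : R),
        hadamard_semidiff f u phi -> hadamard_semidiff g u phi ->
        hadamard_semidiff (fun w => a * f w + b * g w) u phi /\
        semidiff (fun w => a * f w + b * g w) u phi
          = a * semidiff f u phi + b * semidiff g u phi &
      forall (Y : completeNormedModType R) (G : R -> Y),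
        (forall r s : R, hadamard_semidiff G r s) ->
        forall u phi : W,
          hadamard_semidiff (G \o E) u phi /\
          semidiff (G \o E) u phi = semidiff G (E u) (semidiff E u phi)].
Proof.
move=> W E.
have H_cont : \forall x \ae lebesgue n, Omega x -> continuous (H x) := H_car.2.
have HU : ess_uniform Omega H.
  move=> r /H_unif[omega [_ omega_le omega0 hH]]; exists omega; split=> //.
  by move=> X1 X2 X1r X2r X12; have [] := hH X1 X2 X1r X2r X12.
have DHU : ess_uniform Omega (fun x => gradient (H x)).
  move=> r /H_unif[omega [_ omega_le omega0 hH]]; exists omega; split=> //.
  by move=> X1 X2 X1r X2r X12; have [] := hH X1 X2 X1r X2r X12.
have nonneg := lebesgue_open_not_negligible _ Omega Omega_open.
have sd (u phi : W) : [/\ hadamard_semidiff E u phi, penot_semidiff E u phi &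
    fine (ess_sup_superlevel H u phi eps) @[eps --> 0^'+] --> semidiff E u phi].
  have [Om|Om0] := pselect (Omega !=set0).
    exact: (supremal_semidiff _ _ (nonneg Om)).
  (* On the empty domain all essential suprema are $-\infty$, which [fine] sends to 0, so every
     quotient and limit is 0. *)
  have {}Om0 : Omega = set0 by apply/seteqP; split=> // x Ox; apply: Om0; exists x.
  have E0 w : E w = 0.
    by rewrite /E /supremal /ereal_supremal [X in ess_sup_on X]Om0 ess_sup_on0.
  have L0 : (fun eps => fine (ess_sup_superlevel H u phi eps)) = cst 0.
    apply/funext => eps; rewrite /ess_sup_superlevel (_ : [set x | _] = set0) ?ess_sup_on0//.
    by apply/seteqP; split=> // x [+ _]; rewrite [X in X x]Om0.
  have [|-> pen had] := penot_semidiff_cvg E u phi 0.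
    under eq_fun do rewrite !E0 subrr scaler0.
    exact: cvg_cst.
  by split=> //; rewrite L0; exact: cvg_cst.
split=> //.
- move=> Om u phi; split; first exact: ereal_supremal_fin_num (nonneg Om) _ _ _ _.
  exact: superlevel_fin_num (nonneg Om) _ _ _ _ _ _ _ _.
- by move=> u phi f g a b; exact: hadamard_semidiff_linear.
- move=> Y G hG u phi; apply: hadamard_semidiff_comp => //.
  by have [] := sd u phi.
Qed.
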